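(* Let $s,t\ge 0$ and $a,b\ge1$ be integers and let $B$ be the solution of $B(n)=B(n-s-B(n-a))+B(n-t-B(n-b))$ ($n>c$) with positive initial values $B(i)=\xi_i$ ($1\le i\le c$), and suppose this solution is well defined for all $n$. Then for any integer $m>1$, the recurrence $$A(n)=A\Big(n-ms-\sum_{i=1}^m A(n-ma)\Big)+A\Big(n-mt-\sum_{i=1}^m A(n-mb)\Big)\qquad(n>mc),$$ with initial conditions $\xi_1,\dots,\xi_1,\xi_2,\dots,\xi_2,\dots,\xi_c,\dots,\xi_c$ (each $\xi_i$ repeated $m$ times), also has a unique solution, and this solution is the $m$-interleaving of $B$.
   Context: The $m$-interleaving of a sequence $b_1,b_2,b_3,\dots$ is the sequence in which each term is repeated $m$ times: $b_1,\dots,b_1,b_2,\dots,b_2,\dots$ (each block of length $m$), i.e. the sequence $A$ with $A(mn-j)=b_n$ for $0\le j<m$. *)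

(* Defs.v *)
From mathcomp Require Import all_boot all_order all_algebra.
From mathcomp Require Import zify.

Set Implicit Arguments.
Unset Strict Implicit.
Unset Printing Implicit Defensive.

Import Order.TTheory GRing.Theory Num.Theory.
Local Open Scope ring_scope.

(* A sequence A(1), A(2), ... is encoded by a function int -> int of which only
   the values at positive arguments are meaningful; integer indices keep the
   subtractions in the recurrence from being truncated. *)

(* n - s - \sum_(i = 1)^p A(n - a).  For p = 1 this is n - s - A(n - a). *)
Definition outer_index (p : nat) (s a : int) (A : int -> int) (n : int) : int :=
  n - s - \sum_(1 <= i < p.+1) A (n - a).

(* A(n) = A(n - s - \sum_(i = 1)^p A(n - a)) + A(n - t - \sum_(i = 1)^p A(n - b))
   for n > c, and A(i) = xi(i) for 1 <= i <= c.  Alone, this does not ask that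
   the indices on the right-hand side be positive. *)
Definition satisfies_rec (p : nat) (s t a b : int) (c : nat)
    (xi A : int -> int) : Prop :=
  (forall i : int, 1 <= i <= c%:Z -> A i = xi i) /\
  (forall n : int, c%:Z < n ->
     A n = A (outer_index p s a A n) + A (outer_index p t b A n)).

(* For every n > c, computing A(n) only refers to terms among
   A(1), ..., A(n - 1), that is, to terms already computed. *)
Definition well_defined_rec (p : nat) (s t a b : int) (c : nat)
    (A : int -> int) : Prop :=
  forall n : int, c%:Z < n ->
    [/\ 1 <= n - a < n, 1 <= n - b < n,
        1 <= outer_index p s a A n < n & 1 <= outer_index p t b A n < n].

(* The k-th term is the one of index ceil (k / m), written with the floor
   division of int; see interleaveE. *)
Definition interleave (m : nat) (u : int -> int) (k : int) : int :=
  u (- ((- k) %/ m%:Z)%Z).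

Lemma interleaveE (m : nat) (u : int -> int) (n j : int) :
  0 <= j < m%:Z -> interleave m u (m%:Z * n - j) = u n.
Proof.
move=> /andP[j0 jm]; rewrite /interleave; congr (u _).
have m0 : m%:Z != 0 by lia.
rewrite opprB addrC -mulrN mulrC divzMDl // divz_small; last by lia.
by rewrite addr0 opprK.
Qed.

(* Main.v *)
(* Writing k = m n - j with 0 <= j < m, the inner sum over the m-interleaving of
   B equals m B(n - a), so the outer index at k is m (n - s - B(n - a)) - j: it
   has the same offset j and lies in the block of the outer index of B at n.
   Hence the recurrence and its well-definedness transfer block by block. *)
Require Import Defs.
From mathcomp Require Import all_boot all_order all_algebra.
From mathcomp Require Import zify ring.

Set Implicit Arguments.
Unset Strict Implicit.
Unset Printing Implicit Defensive.

Import Order.TTheory GRing.Theory Num.Theory.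
Local Open Scope ring_scope.

Lemma outer_indexE (p : nat) (s a : int) (A : int -> int) (n : int) :
  outer_index p s a A n = n - s - p%:Z * A (n - a).
Proof. by rewrite /outer_index sumr_const_nat subn1 /= -mulr_natl natz. Qed.

Lemma int_ceil_decomp (m : nat) (k : int) :
  (0 < m)%N -> exists n j : int, 0 <= j < m%:Z /\ k = m%:Z * n - j.
Proof.
(* Negating the Euclidean division of [- k] by [m] rounds up instead of down: [n] is the ceiling of
   [k / m], the index used by [interleave], and [j] is the remainder of [- k]. *)
move=> m_gt0; exists (- ((- k) %/ m%:Z)%Z), ((- k) %% m%:Z)%Z.
have m_neq0 : m%:Z != 0 by lia.
rewrite modz_ge0 //= ltz_pmod; last by lia.
by split=> //; rewrite mulrN -opprD mulrC -divz_eq opprK.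
Qed.

Lemma outer_index_interleave (m : nat) (s a : int) (B : int -> int) (n j : int) :
  0 <= j < m%:Z ->
  outer_index m (m%:Z * s) (m%:Z * a) (interleave m B) (m%:Z * n - j) =
  m%:Z * outer_index 1 s a B n - j.
Proof.
move=> j_range; rewrite !outer_indexE.
have -> : m%:Z * n - j - m%:Z * a = m%:Z * (n - a) - j by ring.
by rewrite interleaveE //; ring.
Qed.

Lemma interleave_satisfies_rec (m : nat) (s t a b : int) (c : nat)
    (xi B : int -> int) :
  (0 < m)%N -> satisfies_rec 1 s t a b c xi B ->
  satisfies_rec m (m%:Z * s) (m%:Z * t) (m%:Z * a) (m%:Z * b) (m * c)%N
    (interleave m xi) (interleave m B).
Proof.
move=> m_gt0 [B_init B_rec]; split=> k k_range;
  have [n [j [j_range k_eq]]] := int_ceil_decomp k m_gt0; subst k.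
  (* Since [0 <= j < m], the bounds [1 <= m n - j <= m c] force [1 <= n <= c]; in the recursive case
     below, [m c < m n - j] forces [c < n]. *)
  by rewrite !interleaveE // B_init //; nia.
by rewrite !outer_index_interleave // !interleaveE // -B_rec //; nia.
Qed.

Lemma interleave_well_defined_rec (m : nat) (s t a b : int) (c : nat)
    (B : int -> int) :
  (0 < m)%N -> well_defined_rec 1 s t a b c B ->
  well_defined_rec m (m%:Z * s) (m%:Z * t) (m%:Z * a) (m%:Z * b) (m * c)%N
    (interleave m B).
Proof.
move=> m_gt0 B_wd k k_range.
have [n [j [j_range k_eq]]] := int_ceil_decomp k m_gt0; subst k.
(* The lower bound uses [j < m]: already the first block, [q = 1], gives [m - j >= 1]. The upper
   bound holds because both sides carry the same offset [j]. *)
have block_range (q : int) : 1 <= q < n ->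
    1 <= m%:Z * q - j < m%:Z * n - j by nia.
have shift (d : int) : m%:Z * n - j - m%:Z * d = m%:Z * (n - d) - j by ring.
have n_gt_c : c%:Z < n by nia.
rewrite !outer_index_interleave // !shift.
by have [*] := B_wd n n_gt_c; split; apply: block_range.
Qed.

(** Strong induction on the index. The inner terms at [n - a] and [n - b] come earlier, so both
    sequences compute the same outer indices; well-definedness of [A] places these before [n] too,
    where the values already agree. *)
Lemma satisfies_rec_unique (p : nat) (s t a b : int) (c : nat)
    (xi A A' : int -> int) :
  satisfies_rec p s t a b c xi A -> well_defined_rec p s t a b c A ->
  satisfies_rec p s t a b c xi A' ->
  forall n : int, 1 <= n -> A' n = A n.
Proof.
move=> [A_init A_rec] A_wd [A'_init A'_rec].
(* A natural bound [N] on the integer index turns strong induction into plain induction on [N]. *)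
suff agree (N : nat) (n : int) : 1 <= n < N%:Z -> A' n = A n.
  by move=> n n_ge1; apply: (agree `|n|%N.+1); lia.
elim: N n => [|N IH] n n_range; first by lia.
have [n_le_c|n_gt_c] := lerP n c%:Z.
  by rewrite A_init ?A'_init //; lia.
have [na nb ns nt] := A_wd n n_gt_c.
have IHn (q : int) : 1 <= q < n -> A' q = A q by move=> ?; apply: IH; lia.
have same_index (u d : int) : 1 <= n - d < n ->
    outer_index p u d A' n = outer_index p u d A n.
  by move=> nd; rewrite !outer_indexE IHn.
by rewrite A'_rec // A_rec // !same_index // !IHn.
Qed.

Theorem theorem4p3 (s t a b : int) (c : nat) (xi B : int -> int)
    (hs : 0 <= s) (ht : 0 <= t) (ha : 1 <= a) (hb : 1 <= b)
    (xi_gt0 : forall i : int, 1 <= i <= c%:Z -> 0 < xi i)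
    (B_sol : satisfies_rec 1 s t a b c xi B)
    (B_wd : well_defined_rec 1 s t a b c B)
    (m : nat) (hm : (1 < m)%N) :
  exists A : int -> int,
    [/\ satisfies_rec m (m%:Z * s) (m%:Z * t) (m%:Z * a) (m%:Z * b) (m * c)%N
          (interleave m xi) A,
        well_defined_rec m (m%:Z * s) (m%:Z * t) (m%:Z * a) (m%:Z * b)
          (m * c)%N A,
        (forall A' : int -> int,
           satisfies_rec m (m%:Z * s) (m%:Z * t) (m%:Z * a) (m%:Z * b)
             (m * c)%N (interleave m xi) A' ->
           forall n : int, 1 <= n -> A' n = A n)
      & (forall n : int, 1 <= n -> A n = interleave m B n)].
Proof.
have m_gt0 : (0 < m)%N by exact: ltnW.
have A_sol := interleave_satisfies_rec m_gt0 B_sol.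
have A_wd := interleave_well_defined_rec m_gt0 B_wd.
(* With the interleaving itself as witness, only uniqueness remains. *)
exists (interleave m B); split=> // A' A'_sol.
exact: satisfies_rec_unique A_sol A_wd A'_sol.
Qed.
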